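(* For each integer $n \geq 4$ and each $m \in \mathbb{N}$ there exists a $\mathcal{T}$-group $G$ of Hirsch length $n$ whose genus $\mathfrak{g}(G)$ has more than $m$ elements.
   Context: A $\mathcal{T}$-group is a finitely generated torsion-free nilpotent group. For a group $G$, $F(G)$ denotes the set of isomorphism classes of finite quotients of $G$. For a $\mathcal{T}$-group $G$, the genus $\mathfrak{g}(G)$ is the set of isomorphism classes of $\mathcal{T}$-groups $H$ with $F(G) = F(H)$. The Hirsch length of a $\mathcal{T}$-group is the number of infinite cyclic factors in a subnormal series with infinite cyclic factors. *)

(* Defs.v *)
From HB Require Import structures.
From mathcomp Require Import all_boot.
From mathcomp Require Import boolp classical_sets functions cardinality.

Set Implicit Arguments.
Unset Strict Implicit.
Unset Printing Implicit Defensive.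

Local Open Scope classical_set_scope.
Local Open Scope group_scope.

(* Possibly infinite groups are MathComp [groupType]s; their subsets are
   classical [set]s. *)

Section Subgroups.
Variable G : groupType.
Implicit Types (A K N : set G).

Definition is_subgroup K : Prop :=
  K 1 /\ forall x y, K x -> K y -> K (x / y).

Definition generated_by A : set G := smallest is_subgroup A.

Definition is_normal N K : Prop :=
  [/\ is_subgroup N, is_subgroup K, N `<=` K
    & forall x y, N x -> K y -> N (x ^ y)].

Fixpoint lower_central_series (i : nat) : set G :=
  if i is j.+1
  then generated_by [set [~ x, y] | x in lower_central_series j & y in [set: G]]
  else [set: G].

(* K / N is isomorphic to Q.  An isomorphism K / N -> Q is given by the induced
   map f on K: multiplicative on K, onto Q, and with kernel N.  The values of f
   outside K are irrelevant. *)
Definition factor_isog K N (Q : groupType) : Prop :=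
  is_normal N K /\
  exists f : G -> Q,
    [/\ {in K &, {morph f : x y / x * y}},
        f @` K = [set: Q]
      & K `&` f @^-1` [set 1] = N].

End Subgroups.

Arguments lower_central_series : clear implicits.

Definition finitely_generated (G : groupType) : Prop :=
  exists s : seq G, generated_by [set` s] = [set: G].

Definition torsion_free (G : groupType) : Prop :=
  forall (x : G) (k : nat), (0 < k)%N -> x ^+ k = 1 -> x = 1.

Definition nilpotent_group (G : groupType) : Prop :=
  exists c : nat, lower_central_series G c = [set 1].

Definition T_group (G : groupType) : Prop :=
  [/\ finitely_generated G, torsion_free G & nilpotent_group G].

Definition infinite_cyclic (Q : groupType) : Prop :=
  infinite_set [set: Q] /\ exists a : Q, generated_by [set a] = [set: Q].

(* The relation "G has Hirsch length n": there is a subnormal series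
   1 = K 0 <| K 1 <| ... <| K n = G whose n factors are all infinite cyclic. *)
Definition hirsch_length (G : groupType) (n : nat) : Prop :=
  exists K : nat -> set G,
    [/\ K 0%N = [set 1], K n = [set: G]
      & forall i, (i < n)%N ->
          exists2 Q : groupType,
            infinite_cyclic Q & factor_isog (K i.+1) (K i) Q].

Definition isomorphic (G H : groupType) : Prop :=
  exists2 f : G -> H, {morph f : x y / x * y} & bijective f.

Definition finite_quotient (G Q : groupType) : Prop :=
  finite_set [set: Q] /\ exists N : set G, factor_isog [set: G] N Q.

(* Classes of groups are plain predicates: [set groupType] is not available, its
   universe being too small. *)
Definition group_class := groupType -> Prop.

Definition isomorphism_class (G : groupType) : group_class :=
  fun H => isomorphic G H.

(* F(G) *)
Definition finite_quotient_classes (G : groupType) : group_class -> Prop :=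
  fun C => exists2 Q : groupType, finite_quotient G Q & C = isomorphism_class Q.

Definition genus (G : groupType) : group_class -> Prop :=
  fun C => exists H : groupType,
    [/\ T_group H, finite_quotient_classes G = finite_quotient_classes H
      & C = isomorphism_class H].

Definition has_more_than (m : nat) (X : Type) (P : X -> Prop) : Prop :=
  exists C : 'I_m.+1 -> X, injective C /\ forall i, P (C i).

(* Main.v *)
(* Let G_c be the product of Z^d with the semidirect product of Z^3 by Z in
   which t acts as exp (t N), where N (v1, v2, v3) = (0, 2 r v1, c v1 + 2 r v2).
   If u c' = c + 2 r q, then t |-> u t together with
   (v1, v2, v3) |-> (v1, q v1 + u v2, u^2 v3) embeds G_c' in G_c with index a
   power of u.  When u is moreover coprime to the order of a finite quotient of
   G_c, the image still maps onto that quotient; if c and c' are units modulo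
   2 r, such a u always exists, so that G_c and G_c' have the same finite
   quotients.
   An isomorphism, on the other hand, has to be triangular on Z^3 with signs on
   the diagonal, and to map t to +-t modulo Z^3 x Z^d; comparing the images of
   the commutator of the first basis vector with t gives c' = +- c modulo 2 r.
   With 2 r = 2^(m+2), the groups G_1, G_3, ..., G_(2m+1) are thus pairwise
   non-isomorphic, and their classes lie in a single genus. *)
From HB Require Import structures.
Require Import Defs.
From mathcomp Require Import all_boot all_order all_algebra.
From mathcomp Require Import boolp classical_sets cardinality.
From mathcomp Require Import ring zify.

Set Implicit Arguments.
Unset Strict Implicit.
Unset Printing Implicit Defensive.

Import GRing.Theory Num.Theory.
Local Open Scope classical_set_scope.
Local Open Scope group_scope.

(** * Subgroups and generated subgroups *)

Section SubgroupTheory.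
Variables (G : groupType) (K : set G).
Hypothesis sgK : is_subgroup K.

Lemma subgroup1 : K 1. Proof. by case: sgK. Qed.

Lemma subgroupF x y : K x -> K y -> K (x / y).
Proof. by case: sgK => _; apply. Qed.

Lemma subgroupV x : K x -> K x^-1.
Proof.
by move=> Kx; rewrite -div1g; apply: subgroupF => //; exact: subgroup1.
Qed.

Lemma subgroupM x y : K x -> K y -> K (x * y).
Proof.
by move=> Kx Ky; rewrite -[y]invgK; apply: subgroupF => //; exact: subgroupV.
Qed.

Lemma subgroupX k x : K x -> K (x ^+ k).
Proof.
move=> Kx; elim: k => [|k IHk]; first exact: subgroup1.
by rewrite expgS; exact: subgroupM.
Qed.

Lemma subgroupMl x y : K x -> K (x * y) -> K y.
Proof.
move=> Kx Kxy; rewrite -(mulKg x y).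
by apply: subgroupM => //; exact: subgroupV.
Qed.

(* Bezout: x is a product of powers of x ^+ k = 1 and of x ^+ u. *)
Lemma subgroup_coprime_exp x k u :
  (0 < u)%N -> coprime u k -> x ^+ k = 1 -> K (x ^+ u) -> K x.
Proof.
move=> u_gt0 co_uk xk1 Kxu.
have [v w Dvw _] := egcdnP k u_gt0.
have: K (x ^+ (v * u)) by rewrite mulnC expgnA; exact: subgroupX.
by rewrite Dvw (eqP co_uk) expgnDr mulnC expgnA xk1 expg1n mul1g expg1.
Qed.

End SubgroupTheory.

Lemma generated_by_min (G : groupType) (A K : set G) :
  is_subgroup K -> A `<=` K -> generated_by A `<=` K.
Proof. by move=> sgK sAK; exact: smallest_sub. Qed.

Lemma generated_by_subgroup (G : groupType) (A : set G) :
  is_subgroup (generated_by A).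
Proof.
split=> [B [sgB _]|x y Kx Ky B cB]; first exact: (subgroup1 sgB).
by apply: (subgroupF cB.1); [exact: Kx | exact: Ky].
Qed.

(** * Homomorphisms and finite quotients *)

Section Homomorphisms.
Variables (G Q : groupType) (f : G -> Q).
Hypothesis fM : {morph f : x y / x * y}.

Lemma hom1 : f 1 = 1.
Proof. by apply: (mulgI (f 1)); rewrite -fM !mulg1. Qed.

Lemma homV x : f x^-1 = (f x)^-1.
Proof. by apply: (mulgI (f x)); rewrite -fM !mulgV hom1. Qed.

Lemma homR x y : f [~ x, y] = [~ f x, f y].
Proof. by rewrite !commgEl !conjgE !(fM, homV). Qed.

Lemma homX k x : f (x ^+ k) = f x ^+ k.
Proof. by elim: k => [|k IHk]; rewrite ?expg0 ?hom1 // !expgS fM IHk. Qed.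

Lemma range_subgroup : is_subgroup (range f).
Proof.
split=> [|_ _ [x _ <-] [y _ <-]]; first by exists 1; rewrite ?hom1.
by exists (x / y); rewrite ?fM ?homV.
Qed.

Lemma preimage_subgroup (K : set Q) : is_subgroup K -> is_subgroup (f @^-1` K).
Proof.
move=> sgK; split=> [|x y Kx Ky]; rewrite /preimage /= ?hom1 ?fM ?homV.
  exact: (subgroup1 sgK).
exact: (subgroupF sgK Kx Ky).
Qed.

End Homomorphisms.

(** The normal subgroup is recovered as the kernel, so only a surjective homomorphism has to be
    tracked. *)
Lemma finite_quotientP (G Q : groupType) : finite_quotient G Q <->
  finite_set [set: Q] /\
  exists2 f : G -> Q, {morph f : x y / x * y} & range f = [set: Q].
Proof.
split=> [[finQ [N [_ [f [fM fT _]]]]]|[finQ [f fM fT]]]; split=> //.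
  by exists f => // x y; apply: fM; rewrite inE.
exists (f @^-1` [set 1]); split; last first.
  by exists f; split=> //; rewrite ?setTI // => x y _ _; exact: fM.
have sg1 : is_subgroup [set 1 : Q] by split=> // _ _ -> ->; rewrite /= mulgV.
split=> //; first exact: preimage_subgroup.
by move=> x y /= fx _; rewrite conjgE !fM fx mul1g homV // mulVg.
Qed.

Lemma injective_infinite (T : Type) (f : nat -> T) :
  injective f -> infinite_set [set: T].
Proof.
move=> injf finT; apply: infinite_nat.
rewrite -(eq_finite_set (inj_card_eq (in2W injf))).
exact: sub_finite_set (@subsetT _ _) finT.
Qed.

(** By pigeonhole two powers of each [x i] coincide, and the difference of their exponents serves as
    [o i]. *)
Lemma finite_exponents (Q : groupType) (I : Type) (x : I -> Q) :
  finite_set [set: Q] ->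
  exists2 o : I -> nat, forall i, (0 < o i)%N & forall i, x i ^+ o i = 1.
Proof.
move=> finQ; suff /choice[o oP] : forall i, exists k, (0 < k)%N /\ x i ^+ k = 1.
  by exists o => i; case: (oP i).
move=> i.
have : ~ injective (fun k => x i ^+ k) by move/injective_infinite; apply.
move=> Ninj; apply: contrapT => Nex; apply: Ninj => j k.
wlog lejk: j k / (j <= k)%N => [W|eqjk].
  by case/orP: (leq_total j k) => ? => [|/esym] /W -> //.
have [//|ltjk] := eqVneq j k.
case: Nex; exists (k - j)%N; split; first by rewrite subn_gt0 ltn_neqAle ltjk.
by rewrite expgnFr //= eqjk mulgV.
Qed.

(** * Groups with integer coordinates along a subnormal series *)

Section Coordinates.
Variables (G : groupType) (n : nat) (coord : nat -> G -> int) (e : nat -> G).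

(** The future subnormal series, increasing with [i]. Coordinate [i] will be assumed additive on
    [flag i.+1] only, where its kernel is [flag i]. *)
Definition flag (i : nat) : set G :=
  [set x | forall j, (i <= j < n)%N -> coord j x = 0%R].

Hypothesis coord_inj1 : forall x, flag 0 x -> x = 1.
Hypothesis coordM : forall i x y, (i < n)%N ->
  flag i.+1 x -> flag i.+1 y -> coord i (x * y) = (coord i x + coord i y)%R.
Hypothesis flag_base : forall i, (i < n)%N -> flag i.+1 (e i).
Hypothesis coord_base : forall i, (i < n)%N -> coord i (e i) = 1%R.

Lemma flagS i x : (i < n)%N -> flag i x <-> flag i.+1 x /\ coord i x = 0%R.
Proof.
move=> ltin; split=> [Fx|[Fx xi0] j]; first split=> [j|].
- by case/andP=> ltij ltjn; apply: Fx; rewrite ltjn ltnW.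
- by apply: Fx; rewrite leqnn.
rewrite leq_eqVlt => /andP[/predU1P[<- //|ltij] ltjn].
by apply: Fx; rewrite ltij.
Qed.

Lemma flagT : flag n = [set: G].
Proof. by apply/seteqP; split=> // x _ j; rewrite leqNgt andNb. Qed.

(** Descending induction from the whole group: each flag is the kernel of a coordinate that is
    additive on the next flag. *)
Lemma flag_subgroup i : (i <= n)%N -> is_subgroup (flag i).
Proof.
move=> lein; rewrite -(subKn lein); elim: (n - i)%N => {i lein} [|k IHk].
  by rewrite subn0 flagT.
(* Subtraction is truncated: once [n <= k], both [n - k] and [n - k.+1] are 0. *)
have [ltnk|ltkn] := leqP n k.
  by move: IHk; rewrite -subn_eq0 in ltnk *; rewrite subnS (eqP ltnk).
move: IHk; rewrite -subSS (subSn ltkn); set i := (n - k.+1)%N => sgF.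
have ltin: (i < n)%N by rewrite /i; lia.
have c1 : coord i 1 = 0%R.
  have F1 := subgroup1 sgF; have := coordM ltin F1 F1; rewrite mulg1; lia.
split=> [|x y]; first by apply/flagS => //; split=> //; exact: (subgroup1 sgF).
move=> /flagS[//|Fx x0] /flagS[//|Fy y0]; apply/flagS => //.
split; first exact: (subgroupF sgF).
have FVy := subgroupV sgF Fy.
by have := coordM ltin Fy FVy; rewrite mulgV c1 coordM // x0 y0 !add0r => <-.
Qed.

Lemma coord1 i : (i < n)%N -> coord i 1 = 0%R.
Proof.
have F1 : flag 0 1 by exact: (subgroup1 (flag_subgroup (leq0n n))).
by move=> ltin; exact: F1.
Qed.

Lemma coordV i x : (i < n)%N -> flag i.+1 x -> coord i x^-1 = (- coord i x)%R.
Proof.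
move=> ltin Fx; have FVx := subgroupV (flag_subgroup ltin) Fx.
by have := coordM ltin Fx FVx; rewrite mulgV coord1 //; lia.
Qed.

Lemma coordX i x k : (i < n)%N -> flag i.+1 x ->
  coord i (x ^+ k) = (coord i x *+ k)%R.
Proof.
move=> ltin Fx; elim: k => [|k IHk]; first by rewrite mulr0n coord1.
rewrite expgS coordM ?IHk ?mulrS //; exact: (subgroupX (flag_subgroup ltin)).
Qed.

Lemma coord_onto (K : set G) i z : is_subgroup K -> (i < n)%N -> K (e i) ->
  exists y, [/\ K y, flag i.+1 y & coord i y = z].
Proof.
move=> sgK ltin Ke; have sgF := flag_subgroup ltin.
have KeX k := subgroupX sgK k Ke.
have FeX k := subgroupX sgF k (flag_base ltin).
have cX k : coord i (e i ^+ k) = k%:Z%R.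
  by rewrite coordX ?coord_base ?natz //; exact: flag_base.
case: z => k; first by exists (e i ^+ k).
exists (e i ^+ k.+1)^-1; rewrite (coordV ltin (FeX _)) cX NegzE.
by split; [exact: (subgroupV sgK) | exact: (subgroupV sgF) |].
Qed.

(** Coordinates are cleared from the highest down: dividing by an element of [K] with the same
    leading coordinate lands in the next smaller flag. *)
Lemma subgroup_full (K : set G) :
  is_subgroup K -> (forall i, (i < n)%N -> K (e i)) -> K = [set: G].
Proof.
move=> sgK Ke; suff sFK i : (i <= n)%N -> flag i `<=` K.
  by apply/seteqP; split=> //; rewrite -flagT; exact: sFK.
elim: i => [_ x /coord_inj1->|i IHi ltin x Fx]; first exact: (subgroup1 sgK).
have sgF := flag_subgroup ltin.
have [y [Ky Fy xy]] := coord_onto (coord i x) sgK ltin (Ke _ ltin).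
have Fxy := subgroupF sgF Fx Fy.
rewrite -(mulgVK y x); apply: (subgroupM sgK) => //.
apply: IHi; first exact: ltnW.
apply/flagS => //; split=> //; have FVy := subgroupV sgF Fy.
by rewrite coordM ?coordV // xy subrr.
Qed.

Lemma coordinates_finitely_generated : finitely_generated G.
Proof.
exists [seq e i | i <- iota 0 n]; apply: subgroup_full.
  exact: generated_by_subgroup.
move=> i ltin A [_]; apply; apply: map_f; by rewrite mem_iota.
Qed.

(** Once the higher coordinates of [x] vanish, the next coordinate of [x ^+ k] is [k] times that of
    [x], so it vanishes as well. *)
Lemma coordinates_torsion_free : torsion_free G.
Proof.
move=> x k k_gt0 xk1; apply: coord_inj1.
suff Fx i : (i <= n)%N -> flag (n - i) x by rewrite -(subnn n); exact: Fx.
elim: i => [|i IHi ltin]; first by rewrite subn0 flagT.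
have ltin': (n - i.+1 < n)%N by lia.
have {IHi} Fx := IHi (ltnW ltin); rewrite -subSS (subSn ltin) in Fx.
apply/flagS => //; split=> //; apply/eqP.
have := coordX k ltin' Fx; rewrite xk1 coord1 //; move/esym/eqP.
by rewrite mulrn_eq0 eqn0Ngt k_gt0.
Qed.

Lemma infinite_cyclic_int : infinite_cyclic (Algebra.to_multiplicative int).
Proof.
split; first by apply: (@injective_infinite _ Posz) => i j [].
(* The group law here is integer addition: the integer 1 is a generator, not the neutral element. *)
exists (1%R : int); apply/seteqP; split=> // z _ A [sgA /(_ _ erefl) A1].
have expE k : (1%R : Algebra.to_multiplicative int) ^+ k = Posz k.
  by elim: k => // k IHk; rewrite expgS IHk.
case: z => k; first by rewrite -expE; exact: (subgroupX sgA).
rewrite NegzE -expE; exact: (subgroupV sgA (subgroupX sgA _ A1)).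
Qed.

Lemma coordinates_hirsch_length : hirsch_length G n.
Proof.
exists flag; split; last 1 first.
- move=> i ltin; exists (Algebra.to_multiplicative int).
    exact: infinite_cyclic_int.
  have sgF := flag_subgroup ltin; have sgFi := flag_subgroup (ltnW ltin).
  have sF: flag i `<=` flag i.+1 by move=> x /flagS[].
  split.
    split=> // x y /flagS[//|Fx x0] Fy.
    have Fxy : flag i.+1 (x ^ y).
      exact: (subgroupM sgF (subgroupV sgF Fy) (subgroupM sgF Fx Fy)).
    apply/flagS => //; split=> //; have FVy := subgroupV sgF Fy.
    by rewrite conjgE coordM ?coordV ?coordM ?x0 ?add0r ?addNr //;
      exact: (subgroupM sgF Fx Fy).
  exists (coord i); split.
  - by move=> x y; rewrite !inE; exact: coordM.
  - apply/seteqP; split=> // z _.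
    have [y [_ Fy <-]] := coord_onto z sgF ltin (flag_base ltin).
    by exists y.
  - by apply/seteqP; split=> x /flagS => /(_ ltin).
- apply/seteqP; split=> [x /coord_inj1-> //|_ ->].
  exact: (subgroup1 (flag_subgroup (leq0n n))).
- exact: flagT.
Qed.

End Coordinates.
(* In the product of the semidirect product of Z^3 by Z with Z^d, [top] is the
   coordinate in the acting Z, and [mid1], [mid2], [mid3] are those in Z^3. *)
Record unipotent_group (r c : int) (d : nat) := Unipotent {
  top : int; mid1 : int; mid2 : int; mid3 : int;
  free_part : {ffun 'I_d -> int} }.

(** * The groups [G_c]: group law and commutators *)

Section UnipotentGroup.
Variables (r c : int) (d : nat).
Local Notation gT := (unipotent_group r c d).

(** The tuple encoding transports the choice structure that a [groupType] carries. *)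
Definition unipotent_tuple (g : gT) :=
  (top g, mid1 g, mid2 g, mid3 g, free_part g).
Definition tuple_unipotent
    (s : int * int * int * int * {ffun 'I_d -> int}) : gT :=
  let: (x, y1, y2, y3, v) := s in Unipotent r c x y1 y2 y3 v.

Lemma unipotent_tupleK : cancel unipotent_tuple tuple_unipotent.
Proof. by case. Qed.

HB.instance Definition _ := Choice.copy gT (can_type unipotent_tupleK).

Local Open Scope ring_scope.

Definition unipotent_one : gT := Unipotent r c 0 0 0 0 0.

(* [exp (x N)] is applied to the first factor, where
   [N (v1, v2, v3) = (0, 2 r v1, c v1 + 2 r v2)]. *)
Definition unipotent_mul (g h : gT) : gT :=
  Unipotent r c (top g + top h) (mid1 g + mid1 h)
    (mid2 g + 2 * r * top h * mid1 g + mid2 h)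
    (mid3 g + top h * (c * mid1 g + 2 * r * mid2 g)
       + 2 * r ^+ 2 * top h ^+ 2 * mid1 g + mid3 h)
    (free_part g + free_part h).

(** The vector part is [exp (- x N)] applied to the negated vector. The only nonzero entry of [N^2]
    is [4 r^2], so [N^2 / 2] is integral; this is the origin of [2 * r ^+ 2]. *)
Definition unipotent_inv (g : gT) : gT :=
  Unipotent r c (- top g) (- mid1 g) (- mid2 g + 2 * r * top g * mid1 g)
    (- mid3 g + top g * (c * mid1 g + 2 * r * mid2 g)
       - 2 * r ^+ 2 * top g ^+ 2 * mid1 g)
    (- free_part g).

Lemma unipotent_mulA : associative unipotent_mul.
Proof.
move=> x y z; rewrite /unipotent_mul /=.
by congr Unipotent; rewrite ?addrA //; ring.
Qed.

Lemma unipotent_mul1 : left_id unipotent_one unipotent_mul.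
Proof.
case=> *; rewrite /unipotent_mul /=.
by congr Unipotent; rewrite ?add0r //; ring.
Qed.

Lemma unipotent_mulr1 : right_id unipotent_one unipotent_mul.
Proof.
case=> *; rewrite /unipotent_mul /=.
by congr Unipotent; rewrite ?addr0 //; ring.
Qed.

Lemma unipotent_mulV : left_inverse unipotent_one unipotent_inv unipotent_mul.
Proof.
case=> *; rewrite /unipotent_mul /unipotent_one /=.
by congr Unipotent; rewrite ?addNr //; ring.
Qed.

Lemma unipotent_mulrV : right_inverse unipotent_one unipotent_inv unipotent_mul.
Proof.
case=> *; rewrite /unipotent_mul /unipotent_one /=.
by congr Unipotent; rewrite ?subrr //; ring.
Qed.

HB.instance Definition _ := isGroup.Build gT unipotent_mulA unipotent_mul1
  unipotent_mulr1 unipotent_mulV unipotent_mulrV.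

Lemma unipotent_mulE (g h : gT) : (g * h)%g = unipotent_mul g h.
Proof. by []. Qed.

Lemma unipotent_invE (g : gT) : (g^-1)%g = unipotent_inv g.
Proof. by []. Qed.

Lemma unipotent_commE (g h : gT) :
  let D := mid1 g * top h - mid1 h * top g in
  [~ g, h]%g = Unipotent r c 0 0 (2 * r * D)
    (c * D + 2 * r * (mid2 g * top h - mid2 h * top g)
     + 2 * r ^+ 2 * (mid1 g * (top h ^+ 2) - mid1 h * (top g ^+ 2))) 0.
Proof.
rewrite /= /commg /conjg !unipotent_mulE !unipotent_invE.
rewrite /unipotent_mul /unipotent_inv /=.
congr Unipotent; [ring | ring | ring | ring |].
by apply/ffunP=> i; rewrite !ffunE; ring.
Qed.

End UnipotentGroup.

(** * Coordinates, nilpotency and Hirsch length of [G_c] *)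

Section UnipotentCoordinates.
Variables (r c : int) (d : nat).
Local Notation gT := (unipotent_group r c d).
Local Open Scope ring_scope.

(** Central directions come first: the free part, then [mid3], [mid2], [mid1], and the acting
    coordinate [top] last. In this order each coordinate is additive once the later ones vanish. *)
Definition unipotent_coord (j : nat) (g : gT) : int :=
  if insub j is Some i then free_part g i
  else nth 0 [:: mid3 g; mid2 g; mid1 g; top g] (j - d).

Definition unipotent_base (j : nat) : gT :=
  Unipotent r c (j == d + 3)%N (j == d + 2)%N (j == d + 1)%N (j == d)
    [ffun i : 'I_d => (j == i)%:R].

Lemma unipotent_coord_free (i : 'I_d) g : unipotent_coord i g = free_part g i.
Proof. by rewrite /unipotent_coord valK. Qed.

Lemma unipotent_coordD k g :
  unipotent_coord (d + k) g = nth 0 [:: mid3 g; mid2 g; mid1 g; top g] k.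
Proof. by rewrite /unipotent_coord insubF ?addKn // ltnNge leq_addr. Qed.

Lemma unipotent_baseD k : unipotent_base (d + k) =
  Unipotent r c (k == 3)%N (k == 2)%N (k == 1)%N (k == 0)%N 0.
Proof.
have dk : (d + k == d)%N = (k == 0)%N by rewrite -[X in _ == X]addn0 eqn_add2l.
rewrite /unipotent_base !eqn_add2l dk.
congr Unipotent; apply/ffunP=> i; rewrite !ffunE.
by case: eqP => // eqi; have := ltn_ord i; rewrite -eqi ltnNge leq_addr.
Qed.

Lemma unipotent_topX (x : int) k :
  (Unipotent r c x 0 0 0 0 ^+ k)%g =
  Unipotent r c (x * k%:R) 0 0 0 (0 : {ffun 'I_d -> int}).
Proof.
elim: k => [|k IHk]; first by rewrite mulr0.
rewrite expgS IHk unipotent_mulE /unipotent_mul /=.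
by congr Unipotent; rewrite ?addr0 ?mulrS //; ring.
Qed.

Lemma unipotent_midX (y z : int) k :
  (Unipotent r c 0 0 y z 0 ^+ k)%g =
  Unipotent r c 0 0 (y * k%:R) (z * k%:R) (0 : {ffun 'I_d -> int}).
Proof.
elim: k => [|k IHk]; first by rewrite !mulr0.
rewrite expgS IHk unipotent_mulE /unipotent_mul /=.
by congr Unipotent; rewrite ?addr0 ?mulrS //; ring.
Qed.

Variant unipotent_index_spec : nat -> Prop :=
  | FreeIndex (i : 'I_d) : unipotent_index_spec i
  | UnipotentIndex k of (k < 4)%N : unipotent_index_spec (d + k).

Lemma unipotent_indexP j : (j < d + 4)%N -> unipotent_index_spec j.
Proof.
move=> ltj; have [ltjd|ledj] := ltnP j d.
  by rewrite -[j]/(val (Ordinal ltjd)); constructor.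
by rewrite -(subnKC ledj); constructor; lia.
Qed.

Lemma flag_coord_eq0 i k g : flag (d + 4) unipotent_coord i g ->
  (i <= d + k)%N -> (k < 4)%N ->
  nth 0 [:: mid3 g; mid2 g; mid1 g; top g] k = 0.
Proof. by move=> Fg ik k4; rewrite -unipotent_coordD Fg // ik ltn_add2l. Qed.

Lemma unipotent_coord_inj1 g : flag (d + 4) unipotent_coord 0 g -> g = 1%g.
Proof.
move=> Fg; have F0 k := flag_coord_eq0 Fg (leq0n (d + k)).
have gv : free_part g = 0.
  by apply/ffunP=> i; rewrite ffunE -unipotent_coord_free Fg //= ltn_addr.
have /= := (F0 0 isT, F0 1 isT, F0 2 isT, F0 3 isT)%N.
by case: g {Fg F0} gv => ? ? ? ? ? /= -> [[[-> ->] ->] ->].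
Qed.

Lemma unipotent_coordM j g h : (j < d + 4)%N ->
  flag (d + 4) unipotent_coord j.+1 g -> flag (d + 4) unipotent_coord j.+1 h ->
  unipotent_coord j (g * h)%g = unipotent_coord j g + unipotent_coord j h.
Proof.
move=> /unipotent_indexP[i|k k4] Fg Fh.
  by rewrite !unipotent_coord_free ffunE.
rewrite !unipotent_coordD unipotent_mulE.
have g0 l := flag_coord_eq0 (k := l) Fg.
have h0 l := flag_coord_eq0 (k := l) Fh.
move: {Fg Fh} g0 h0 k4; rewrite -addnS.
case: k => [|[|[|[|//]]]] g0 h0 _ /=.
- have /= -> := g0 2 _ isT; last by rewrite leq_add2l.
  have /= -> := g0 1 _ isT; last by rewrite leq_add2l.
  by ring.
- by have /= -> := g0 2 _ isT; [ring | rewrite leq_add2l].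
- by [].
- by [].
Qed.

Lemma unipotent_base_flag j :
  (j < d + 4)%N -> flag (d + 4) unipotent_coord j.+1 (unipotent_base j).
Proof.
move=> ltj l /andP[+ /unipotent_indexP Il].
case: Il => [i|k k4] ltjl; last first.
  rewrite unipotent_coordD; case: k => [|[|[|[|//]]]] in k4 ltjl *; rewrite /=;
  case: eqP => //; lia.
by rewrite unipotent_coord_free ffunE; case: eqP => //; lia.
Qed.

Lemma unipotent_base_coord j :
  (j < d + 4)%N -> unipotent_coord j (unipotent_base j) = 1.
Proof.
move=> /unipotent_indexP[i|k k4].
  by rewrite unipotent_coord_free ffunE eqxx.
rewrite unipotent_coordD; case: k => [|[|[|[|//]]]] in k4 *; rewrite /=;
case: eqP => //; lia.
Qed.

Lemma commutator_subgroup_min (A K : set gT) : is_subgroup K ->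
  (forall x y, A x -> K [~ x, y]%g) ->
  generated_by [set [~ x, y]%g | x in A & y in [set: gT]] `<=` K.
Proof.
move=> sgK AK; apply: generated_by_min => // _ [x Ax [y _ <-]]; exact: AK.
Qed.

(** The first commutation kills [top], [mid1] and the free part, the second also [mid2], the third
    also [mid3]. *)
Lemma unipotent_nilpotent : nilpotent_group gT.
Proof.
pose K1 := [set g : gT | [/\ top g = 0, mid1 g = 0 & free_part g = 0]].
pose K2 := [set g : gT | K1 g /\ mid2 g = 0].
have sgK1 : is_subgroup K1.
  split=> // x y [/= x1 x2 x3] [/= y1 y2 y3]; split => /=.
  - by rewrite x1 y1.
  - by rewrite x2 y2.
  - by rewrite x3 y3 subrr.
have sgK2 : is_subgroup K2.
  split=> // x y [x1 x2] [y1 y2]; split; first exact: (subgroupF sgK1 x1 y1).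
  case: x1 y1 => /= x10 x11 _ [/= y10 y11 _].
  by rewrite x2 y2 x11 y11 y10; ring.
have s1 : lower_central_series gT 1 `<=` K1.
  by apply: commutator_subgroup_min => // x y _; rewrite unipotent_commE.
have s2 : lower_central_series gT 2 `<=` K2.
  apply: commutator_subgroup_min => // x y /s1[x0 x1 _].
  by rewrite unipotent_commE; split=> //=; rewrite x0 x1; ring.
exists 3; apply/seteqP; split.
  apply: commutator_subgroup_min => [|x y /s2[[x0 x1 _] x2]].
    by split=> // _ _ -> ->; rewrite mulgV.
  by rewrite unipotent_commE x0 x1 x2 /=; congr Unipotent; ring.
by move=> _ ->; exact: (subgroup1 (generated_by_subgroup _)).
Qed.

Lemma unipotent_T_group : T_group gT.
Proof.
split; last exact: unipotent_nilpotent.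
- exact: (coordinates_finitely_generated unipotent_coord_inj1 unipotent_coordM
    unipotent_base_flag unipotent_base_coord).
- exact: (coordinates_torsion_free unipotent_coord_inj1 unipotent_coordM).
Qed.

Lemma unipotent_hirsch_length : hirsch_length gT (d + 4).
Proof.
exact: (coordinates_hirsch_length unipotent_coord_inj1 unipotent_coordM
    unipotent_base_flag unipotent_base_coord).
Qed.

End UnipotentCoordinates.

Local Open Scope ring_scope.

(** * Carrying finite quotients from [G_c] to [G_c'] *)

Section UnipotentQuotients.
Variables (r c c' : int) (d u : nat) (q : int).
Hypothesis Du : (u%:Z * c' = c + 2 * r * q).
Local Notation G := (unipotent_group r c d).
Local Notation G' := (unipotent_group r c' d).

(* The linear part P of this map satisfies P N' = u N P, so that it embeds G'
   in G, with image of index u ^ 4. *)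
Definition unipotent_embedding (g : G') : G :=
  Unipotent r c (u%:Z * top g) (mid1 g) (q * mid1 g + u%:Z * mid2 g)
    (u%:Z ^+ 2 * mid3 g) (free_part g).

Lemma unipotent_embeddingM : {morph unipotent_embedding : x y / (x * y)%g}.
Proof.
move=> g h; rewrite !unipotent_mulE /unipotent_mul /unipotent_embedding /=.
congr Unipotent; [ring | ring |].
(* The term in [c'] is isolated with a factor [u], so that [Du] can replace [u c']. *)
have -> : u%:Z ^+ 2 * (mid3 g + top h * (c' * mid1 g + 2 * r * mid2 g) +
    2 * r ^+ 2 * top h ^+ 2 * mid1 g + mid3 h) =
    u%:Z ^+ 2 * (mid3 g + top h * (2 * r * mid2 g) +
    2 * r ^+ 2 * top h ^+ 2 * mid1 g + mid3 h) +
    u%:Z * top h * mid1 g * (u%:Z * c') by ring.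
by rewrite Du; ring.
Qed.

(** Up to a correction for [mid1], the embedding reaches each basis element to the power 1, [u] or
    [u ^ 2]. In [Q] such a power generates the same cyclic subgroup, [u] being coprime to an
    exponent of the basis image. *)
Lemma unipotent_quotient_onto (Q : groupType) (f : G -> Q) :
  (0 < u)%N -> {morph f : x y / (x * y)%g} -> range f = [set: Q] ->
  (forall j, (j < d + 4)%N ->
    exists2 k, coprime u k & f (unipotent_base r c d j) ^+ k = 1)%g ->
  range (f \o unipotent_embedding) = [set: Q].
Proof.
move=> u_gt0 fM fT ord_f; set S := range _.
have sgS : is_subgroup S.
  by apply: range_subgroup => x y /=; rewrite unipotent_embeddingM fM.
have SX l j : (j < 4)%N -> S (f (unipotent_base r c d (d + j)) ^+ (u ^ l))%g ->
    S (f (unipotent_base r c d (d + j))).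
  move=> j4; have [|k co_uk fk] := ord_f (d + j)%N; first by rewrite ltn_add2l.
  by apply: (subgroup_coprime_exp sgS _ _ fk);
    rewrite ?expn_gt0 ?u_gt0 ?coprimeXl.
have Sphi g : S (f (unipotent_embedding g)) by exists g.
suff: f @^-1` S = [set: G].
  move=> fS; apply/seteqP; split=> // y _.
  have [x _ <-] : range f y by rewrite fT.
  by have: [set: G] x by []; rewrite -fS.
apply: (subgroup_full (@unipotent_coord_inj1 r c d) (@unipotent_coordM r c d)
  (@unipotent_base_flag r c d) (@unipotent_base_coord r c d)).
  exact: preimage_subgroup.
have S3 : S (f (unipotent_base r c d (d + 0))).
  apply: (SX 2 0 isT)%N; rewrite -homX // unipotent_baseD unipotent_midX mul0r.
  have := Sphi (unipotent_base r c' d (d + 0)); rewrite unipotent_baseD.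
  rewrite /unipotent_embedding /= ?mulr0 ?mulr1 ?mul1r ?add0r ?addr0.
  by rewrite ?expn1 ?natrX natz.
have S2 : S (f (unipotent_base r c d (d + 1))).
  apply: (SX 1 1 isT)%N; rewrite -homX // unipotent_baseD unipotent_midX mul0r.
  have := Sphi (unipotent_base r c' d (d + 1)); rewrite unipotent_baseD.
  rewrite /unipotent_embedding /= ?mulr0 ?mulr1 ?mul1r ?add0r ?addr0.
  by rewrite ?expn1 ?natrX natz.
have S0 : S (f (unipotent_base r c d (d + 3))).
  apply: (SX 1 3 isT)%N; rewrite -homX // unipotent_baseD unipotent_topX.
  have := Sphi (unipotent_base r c' d (d + 3)); rewrite unipotent_baseD.
  rewrite /unipotent_embedding /= ?mulr0 ?mulr1 ?mul1r ?add0r ?addr0.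
  by rewrite ?expn1 ?natrX natz.
(* The embedded [mid1] basis vector has an extra [mid2] entry [q]; it is divided off, as the image
   of the whole [mid2] line already lies in [S]. *)
have S1 : S (f (unipotent_base r c d (d + 2))).
  have := Sphi (unipotent_base r c' d (d + 2)); rewrite !unipotent_baseD.
  rewrite /unipotent_embedding /= ?mulr0 ?mulr1 ?addr0.
  have -> : Unipotent r c 0 1 q 0 (0 : {ffun 'I_d -> int}) =
      (Unipotent r c 0 0 q 0 0 * Unipotent r c 0 1 0 0 0)%g.
    by rewrite unipotent_mulE; congr Unipotent; rewrite /= ?addr0 //; ring.
rewrite fM; apply: (subgroupMl sgS).
  suff Sz z : S (f (Unipotent r c 0 0 z 0 0)) by exact: Sz.
  move: S2; rewrite unipotent_baseD => S2.
  have Sk (k : nat) : S (f (Unipotent r c 0 0 k 0 0)).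
    have := subgroupX sgS k S2; rewrite -homX // unipotent_midX.
    by rewrite mul1r mul0r natz.
  case: z => k; first exact: Sk.
  have := subgroupV sgS (Sk k.+1); rewrite -homV //; congr (S (f _)).
  by rewrite unipotent_invE; congr Unipotent; rewrite /= ?oppr0 // ?NegzE; ring.
move=> _ /unipotent_indexP[i|[|[|[|[|//]]]] _] //.
exists (unipotent_base r c' d i) => //=; congr f.
rewrite /unipotent_embedding /unipotent_base /=; case: i => i lti /=.
by congr Unipotent;
  do ?[rewrite (_ : (i == _) = false); last lia]; rewrite ?mulr0.
Qed.

End UnipotentQuotients.

(** * Rigidity of homomorphisms between the groups [G_c] *)

Lemma additive_int (f : int -> int) :
  (forall x y, f (x + y) = f x + f y) -> forall z, f z = z * f 1.
Proof.
move=> fD z; have f0 : f 0 = 0 by have := fD 0 0; rewrite addr0; lia.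
elim: z => [|k IHk|k IHk]; first by rewrite f0 mul0r.
  by rewrite -add1n PoszD fD IHk; ring.
have := fD (- (k.+1)%:Z) 1; have -> : - k.+1%:Z + 1 = - k%:Z by lia.
by rewrite IHk => /eqP; rewrite -subr_eq => /eqP <-; rewrite -add1n PoszD; ring.
Qed.

Lemma int_unit (x y : int) : x * y = 1 -> x = 1 \/ x = -1.
Proof.
move=> /(congr1 absz)/eqP; rewrite abszM muln_eq1 => /andP[/eqP x1 _]; lia.
Qed.

Section AdditiveLine.
Variables (r c : int) (d : nat) (l : int -> unipotent_group r c d).
Hypothesis lD : forall x y, l (x + y) = (l x * l y)%g.

Lemma additive_line_top z : top (l z) = z * top (l 1).
Proof.
by apply: (@additive_int (fun x => top (l x)) _ z) => x y; rewrite lD.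
Qed.

(** Where [top] vanishes the group law is coordinatewise addition, so every coordinate of [l] is
    additive. *)
Lemma additive_line z : top (l 1) = 0 ->
  l z = Unipotent r c 0 (z * mid1 (l 1)) (z * mid2 (l 1)) (z * mid3 (l 1))
    [ffun i => z * free_part (l 1) i].
Proof.
move=> t0; have l0 x : top (l x) = 0 by rewrite additive_line_top t0 mulr0.
have lin (h : unipotent_group r c d -> int) :
    (forall x y, h (l x * l y)%g = h (l x) + h (l y)) -> h (l z) = z * h (l 1).
  move=> hD; apply: (@additive_int (fun x => h (l x)) _ z) => x y.
  by rewrite lD hD.
case Dlz: (l z) (l0 z) lin => [x y1 y2 y3 v] /= -> lin.
have linf i := lin (fun g => free_part g i).
have {lin} := (lin (@mid1 _ _ _), lin (@mid2 _ _ _), lin (@mid3 _ _ _)).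
case=> [[lin1 lin2] lin3]; congr Unipotent.
- by apply: lin1 => x' y'.
- by apply: lin2 => x' y'; rewrite /= l0; ring.
- by apply: lin3 => x' y'; rewrite /= l0; ring.
- by apply/ffunP=> i; rewrite ffunE; apply: linf => x' y'; rewrite ffunE.
Qed.

End AdditiveLine.

Section UnipotentHomomorphisms.
Variables (r c c' : int) (d : nat).
Hypothesis r_neq0 : r != 0.
Local Notation G := (unipotent_group r c d).
Local Notation G' := (unipotent_group r c' d).
Local Notation mid y z := (Unipotent r c 0 0 y z (0 : {ffun 'I_d -> int})).
Local Notation e0 := (Unipotent r c 1 0 0 0 (0 : {ffun 'I_d -> int})).
Local Notation e1 := (Unipotent r c 0 1 0 0 (0 : {ffun 'I_d -> int})).

Lemma mid_mul y z y' z' : mid (y + y') (z + z') = (mid y z * mid y' z')%g.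
Proof.
by rewrite unipotent_mulE; congr Unipotent; rewrite /= ?addr0 //; ring.
Qed.

(** This commutator carries [c]; its image under an isomorphism reveals the parameter. *)
Lemma commutator_e1_e0 : [~ e1, e0]%g = mid (2 * r) (c + 2 * r ^+ 2).
Proof. by rewrite unipotent_commE /=; congr Unipotent; ring. Qed.

Lemma commutator_mid_e0 y z : [~ mid y z, e0]%g = mid 0 (2 * r * y).
Proof. by rewrite unipotent_commE /=; congr Unipotent; ring. Qed.

Lemma commutator_mid_e1 y z : [~ mid y z, e1]%g = 1%g.
Proof. by rewrite unipotent_commE /=; congr Unipotent; ring. Qed.

Variable f : G -> G'.
Hypothesis fM : {morph f : x y / (x * y)%g}.

Let lmid2 y := f (mid y 0).
Let lmid3 z := f (mid 0 z).

Let lmid2D x y : lmid2 (x + y) = (lmid2 x * lmid2 y)%g.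
Proof. by rewrite /lmid2 -fM -mid_mul addr0. Qed.

Let lmid3D x y : lmid3 (x + y) = (lmid3 x * lmid3 y)%g.
Proof. by rewrite /lmid3 -fM -mid_mul addr0. Qed.

Let f_mid y z : f (mid y z) = (lmid2 y * lmid3 z)%g.
Proof. by rewrite -fM -mid_mul addr0 add0r. Qed.

(* [mid 0 (4 r^2)] is a double commutator, and the double commutators of G' lie
   in the line of [mid3]. *)
Lemma hom_mid3 : exists p, forall z,
  f (mid 0 z) = Unipotent r c' 0 0 0 (z * p) 0.
Proof.
have comm2 : lmid3 (2 * r * (2 * r)) = [~ [~ f e1, f e0], f e0]%g.
  by rewrite -!homR // commutator_e1_e0 commutator_mid_e0.
have r2_neq0 : 2 * r * (2 * r) != 0 by rewrite !mulf_neq0.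
have t0 : top (lmid3 1) = 0.
  apply: (mulfI r2_neq0); rewrite -(additive_line_top lmid3D) comm2.
  by rewrite mulr0 unipotent_commE.
have r2I x : 2 * r * (2 * r) * x = 0 -> x = 0.
  by move/eqP; rewrite mulf_eq0 (negPf r2_neq0) => /eqP.
exists (mid3 (lmid3 1)) => z; rewrite -/(lmid3 z).
have lineE y := additive_line lmid3D y t0.
have := lineE (2 * r * (2 * r)).
rewrite comm2 !unipotent_commE /= => -[E1 E2 _ /ffunP E4].
rewrite lineE; congr Unipotent.
- by rewrite (r2I (mid1 (lmid3 1))) ?mulr0.
- by rewrite (r2I (mid2 (lmid3 1))) ?mulr0 // -E2; ring.
- apply/ffunP=> i; have := E4 i; rewrite !ffunE => E.
  by rewrite (r2I (free_part (lmid3 1) i)) ?mulr0.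
Qed.

(** Up to the [mid3] line, [2 r] times the [mid2] generator is a commutator, so its image has [top]
    and [mid1] zero; [2 r] is then cancelled. The diagonal entry of [f] is [m], and [s] is the entry
    below it. *)
Lemma hom_mid2 : exists m s (v : {ffun 'I_d -> int}), forall p, (forall z,
  f (mid 0 z) = Unipotent r c' 0 0 0 (z * p) 0) -> forall y z,
  f (mid y z) = Unipotent r c' 0 0 (y * m) (y * s + z * p) [ffun i => y * v i].
Proof.
exists (mid2 (lmid2 1)), (mid3 (lmid2 1)), (free_part (lmid2 1)) => p fp y z.
have r2_neq0 : 2 * r != 0 by rewrite mulf_neq0.
have comm1 : f (mid (2 * r) (c + 2 * r ^+ 2)) = [~ f e1, f e0]%g.
  by rewrite -homR // commutator_e1_e0.
have fmE u v : f (mid u v) = (lmid2 u * Unipotent r c' 0 0 0 (v * p) 0)%g.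
  by rewrite f_mid /lmid3 fp.
have t0 : top (lmid2 1) = 0.
  apply: (mulfI r2_neq0); rewrite -(additive_line_top lmid2D) mulr0.
  have /(congr1 (@top _ _ _)) := comm1.
  by rewrite unipotent_commE fmE unipotent_mulE /= addr0.
have lineE y := additive_line lmid2D y t0.
have m0 : mid1 (lmid2 1) = 0.
  apply: (mulfI r2_neq0); have /(congr1 (@mid1 _ _ _)) := comm1.
  by rewrite unipotent_commE fmE unipotent_mulE lineE /= addr0 mulr0.
rewrite fmE lineE m0 unipotent_mulE.
by congr Unipotent; rewrite /= ?addr0 //; ring.
Qed.

(* [top (f e0)] and the diagonal entries of f on Z^3 are signs, since the last
   of these entries has the inverse q. *)
Lemma hom_congruence (q : int) : (forall p, (forall z,
    f (mid 0 z) = Unipotent r c' 0 0 0 (z * p) 0) -> p * q = 1) ->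
  exists k, c' = c + 2 * r * k \/ c' = - c + 2 * r * k.
Proof.
move=> unit_p; have [p fp] := hom_mid3; have {unit_p} pq := unit_p p fp.
have [m [s [v /(_ p fp) fm]]] := hom_mid2.
have r2_neq0 : 2 * r != 0 by rewrite mulf_neq0.
set u := top (f e0).
have := homR fM (mid 1 0) e0.
rewrite commutator_mid_e0 fp !fm unipotent_commE /=.
rewrite -/u => -[_ Ep].
have {}Ep : p = m * u.
  by apply: (mulfI r2_neq0); rewrite mulr1 in Ep; rewrite Ep; ring.
(* [mid 1 0] commutes with [e1]; since [m] is nonzero, the image of [e1] must have [top] zero. *)
have := homR fM (mid 1 0) e1.
rewrite commutator_mid_e1 hom1 // fm unipotent_commE /=.
move=> /(congr1 (@mid3 _ _ _)) /= E1.
have t1 : top (f e1) = 0.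
  have : 2 * r * (m * top (f e1)) = 0 by rewrite [RHS]E1; ring.
  move/eqP; rewrite mulf_eq0 (negPf r2_neq0) mulf_eq0 /=.
  move=> /orP[/eqP m0|/eqP //].
  by move: pq; rewrite Ep m0 !mul0r.
have := homR fM e1 e0.
rewrite commutator_e1_e0 fm unipotent_commE t1 /= -/u => -[Em Es _].
have {}Em : m = mid1 (f e1) * u by apply: (mulfI r2_neq0); rewrite Em; ring.
have m_unit : m * (u * q) = 1 by rewrite mulrA -Ep.
have u_unit : u * (m * q) = 1 by rewrite mulrCA mulrA -Ep.
(* Solving the [mid3] equation [Es] for [c'] gives [c' = u c + 2 r m (s - mid2 (f e1) u)], and
   [m = p u] because [u] is a sign. *)
exists (p * u * (s - mid2 (f e1) * u)).
move: (int_unit m_unit) (int_unit u_unit) Ep Em Es; clearbody u; clear.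
move: (mid1 (f e1)) (mid2 (f e1)) => a w [] -> [] -> -> Ea Es.
- have {}Ea : a = 1 by lia.
  by rewrite Ea in Es; lia.
- have {}Ea : a = -1 by lia.
  by rewrite Ea in Es; lia.
- have {}Ea : a = -1 by lia.
  by rewrite Ea in Es; lia.
- have {}Ea : a = 1 by lia.
  by rewrite Ea in Es; lia.
Qed.

End UnipotentHomomorphisms.

(** The inverse isomorphism also scales the [mid3] line, and the two factors multiply to 1. *)
Lemma unipotent_isomorphic (r c c' : int) (d : nat) : r != 0 ->
  isomorphic (unipotent_group r c d) (unipotent_group r c' d) ->
  exists k, c' = c + 2 * r * k \/ c' = - c + 2 * r * k.
Proof.
move=> r_neq0 [f fM [g fK gK]].
have gM : {morph g : x y / (x * y)%g}.
  by move=> x y; rewrite -[in LHS](gK x) -[in LHS](gK y) -fM fK.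
have [q gq] := hom_mid3 r_neq0 gM.
apply: (hom_congruence r_neq0 fM (q := q)) => p fp.
have := fK (Unipotent r c 0 0 0 1 0); rewrite fp gq => -[].
by rewrite mul1r.
Qed.

(** * Common finite quotients and the size of the genus *)

Lemma exists_odd_multiplier (k c c' M : nat) : odd c -> odd c' -> (0 < M)%N ->
  exists u (q : int),
    [/\ (0 < u)%N, coprime u M & u%:Z * c'%:Z = c%:Z + 2 * (2 ^ k)%N%:Z * q].
Proof.
move=> odd_c odd_c' M_gt0; set a := (2 ^ k.+1)%N.
have co_a x : odd x -> coprime x a.
  by move=> odd_x; rewrite coprimeXr // coprimen2.
(* A multiple of [c'] congruent to [c] modulo [a], divided by [c'], represents the quotient of [c]
   by [c'] modulo [a]. *)
pose u0 := (chinese c' a 0 c %/ c')%N.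
have u0c : (u0 * c' = c %[mod a])%N.
  rewrite divnK ?chinese_modr ?co_a //.
  by rewrite /dvdn chinese_modl ?co_a // mod0n.
have co_aM : coprime a (M`_(2^')%N).
  rewrite coprimeXl // coprime2n; have := part_pnat (2^')%N M.
  by rewrite p'natE // dvdn2 negbK.
(* The congruence modulo [a] makes [u] odd; being 1 modulo the odd part of [M], it is then coprime
   to [M]. *)
pose u := chinese a (M`_(2^')%N) u0 1.
have uc : (u * c' = c %[mod a])%N.
  by rewrite -modnMml chinese_modl // modnMml.
have odd_u : odd u.
  have: (u * c' = c %[mod 2])%N.
    by rewrite -(modn_dvdm (m := a)) ?uc ?modn_dvdm // dvdn_exp.
  by rewrite !modn2 oddM odd_c odd_c' andbT; case: odd.
have u_mod : (u = 1 %[mod M`_(2^')%N])%N by rewrite chinese_modr.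
have [q Dq] : exists q : int, u%:Z * c'%:Z = c%:Z + a%:Z * q.
  exists ((u * c' %/ a)%:Z - (c %/ a)%:Z).
  rewrite -PoszM {1}(divn_eq (u * c') a) {1}(divn_eq c a) uc.
  by rewrite !PoszD !PoszM; ring.
exists u, q; split; first exact: odd_gt0.
  rewrite -(partnC 2%N M_gt0) coprimeMr p_part coprimeXr ?coprimen2 //=.
  by rewrite -coprime_modl u_mod coprime_modl coprime1n.
by rewrite Dq /a expnS PoszM.
Qed.

Lemma unipotent_finite_quotient (k c c' d : nat) (Q : groupType) :
  odd c -> odd c' ->
  finite_quotient (unipotent_group (2 ^ k)%N c d) Q ->
  finite_quotient (unipotent_group (2 ^ k)%N c' d) Q.
Proof.
move=> odd_c odd_c' /finite_quotientP[finQ [f fM fT]]; apply/finite_quotientP.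
split=> //.
have [o o_gt0 fo] :=
  finite_exponents (fun j => f (unipotent_base (2 ^ k)%N c d j)) finQ.
(* Coprimality to the product handles the exponents of all basis images at once; [u] thus depends on
   the quotient. *)
have [|u [q [u_gt0 co_u Du]]] :=
  @exists_odd_multiplier k c c' (\prod_(j < d + 4) o j) odd_c odd_c'.
  exact: prodn_gt0.
exists (f \o @unipotent_embedding (2 ^ k)%N c c' d u q) => [x y|] /=.
  by rewrite (unipotent_embeddingM Du) fM.
apply: (unipotent_quotient_onto Du) => // j ltj; exists (o j) => //.
by apply: coprime_dvdr co_u; rewrite (bigD1 (Ordinal ltj)) //= dvdn_mulr.
Qed.

Theorem theorem1 :
  forall n : nat, (4 <= n)%N -> forall m : nat,
  exists G : groupType,
    [/\ T_group G, hirsch_length G n & has_more_than m (genus G)].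
Proof.
move=> n n_ge4 m; pose d := (n - 4)%N; pose r := (2 ^ m.+1)%N.
pose G (i : nat) : groupType := unipotent_group r i.*2.+1 d.
have TG i : T_group (G i) by exact: unipotent_T_group.
exists (G 0%N); split=> //.
  by rewrite -(subnK n_ge4); exact: unipotent_hirsch_length.
exists (fun i : 'I_m.+1 => isomorphism_class (G i)).
split=> [i j eqij|i]; last first.
  (* All parameters [i.*2.+1] are odd, so finite quotients transfer in both directions. *)
  exists (G i); split=> //; apply/predeqP => C.
  by split=> -[Q GQ ->]; exists Q => //; move: GQ;
    apply: unipotent_finite_quotient; rewrite /= ?odd_double.
have /unipotent_isomorphic[] : isomorphic (G i) (G j).
- have: isomorphism_class (G j) (G j) by exists id => //; exists id.
  by rewrite -eqij.
- by rewrite eqz_nat expn_eq0.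
have lti := ltn_ord i; have ltj := ltn_ord j.
(* From [m < 2 ^ m], the sum of the two parameters is positive and less than [2 ^ (m + 2)], hence
   not a multiple of it; their difference is smaller still in absolute value, hence zero. *)
have ltm := ltn_expl m (isT : 1 < 2)%N.
move=> k; rewrite /r expnS => Dk; apply: val_inj => /=.
have : (k = 0 \/ 1 <= k \/ k <= -1) by lia.
nia.
Qed.
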